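(* Consider ${\rm CHC}_R(\mathbf k,\mathbf n,\lambda)$ under regime (A1), and let $$(\hat I_1,\dots,\hat I_d)\in\arg\max_{I_i\subseteq[n_i],\,|I_i|=k_i}\ \sum_{i_1\in I_1}\cdots\sum_{i_d\in I_d}\mathcal Y_{[i_1,\dots,i_d]}.$$ There exists $C_0>0$ (depending only on $d$) such that if $$\lambda\ge C_0\sqrt{\frac{\sum_{i=1}^d\log(n_i-k_i)}{\min_{1\le i\le d}\prod_{z\ne i}k_z}},$$ then $(\hat I_1,\dots,\hat I_d)=S(\mathcal X)$ with probability at least $1-C\sum_{i=1}^d(n_i-k_i)^{-c}$ for some constants $c,C>0$, uniformly over $\mathcal X\in\mathscr X_{\rm CHC}(\mathbf k,\mathbf n,\lambda)$. Moreover, under regime (A2), this estimator achieves reliable recovery (risk $\to0$) whenever $\beta<(d-1)\alpha/2$.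
   Context: Model: $\mathcal Y=\mathcal X+\mathcal Z\in\mathbb R^{n_1\times\cdots\times n_d}$, $\mathcal Z$ with i.i.d. $N(0,1)$ entries. $\mathscr X_{\rm CHC}(\mathbf k,\mathbf n,\lambda)=\{\lambda'\mathbf 1_{I_1}\circ\cdots\circ\mathbf 1_{I_d}: I_i\subseteq[n_i],|I_i|=k_i,\lambda'\ge\lambda\}$, where $\mathbf 1_I$ is the indicator vector of $I$; $S(\mathcal X)=(I_1,\dots,I_d)$. Regime (A1): for all $i$, $n_i\to\infty$, $k_i\to\infty$, $k_i/n_i\to0$. Regime (A2): fixed $\alpha\in[0,1]$, $\beta\in\mathbb R$; $n\to\infty$, $n_1=\dots=n_d$ with $\log n_i/\log n\to1$, $k_i=k$ with $\log k/\log n\to\alpha$, $\log(1/\lambda)/\log n\to\beta$. *)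

(* Defs.v *)
From HB Require Import structures.
From mathcomp Require Import all_boot all_order all_algebra.
From mathcomp Require Import all_classical all_reals all_analysis.
Set Implicit Arguments. Unset Strict Implicit. Unset Printing Implicit Defensive.
Import Order.TTheory GRing.Theory Num.Theory.
Import numFieldNormedType.Exports.
Local Open Scope classical_set_scope.
Local Open Scope ring_scope.

Notation tidx n := {dffun forall i, 'I_(n i)}.
Notation supp n := {dffun forall i, {set 'I_(n i)}}.

Section defs.
Context {R : realType} {d : nat}.

Definition admissible (n k : 'I_d -> nat) (I : supp n) : Prop :=
  forall i, #|I i| = k i.

Definition in_block (n : 'I_d -> nat) (I : supp n) (x : tidx n) : bool :=
  [forall i, x i \in I i].

Definition block_tensor (n : 'I_d -> nat) (lam' : R) (I : supp n) : tidx n -> R :=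
  fun x => if in_block I x then lam' else 0.

Definition block_score (n : 'I_d -> nat) (Y : tidx n -> R) (I : supp n) : R :=
  \sum_(x : tidx n | in_block I x) Y x.

(* the event that I is the unique maximiser of the block score over all
   admissible (k_1,...,k_d)-blocks, i.e. every argmax equals I *)
Definition unique_argmax (n k : 'I_d -> nat) (Y : tidx n -> R) (I : supp n) : Prop :=
  forall J : supp n, admissible k J -> J != I -> block_score Y J < block_score Y I.
End defs.

Definition mutually_independent {R : realType} {dT} {T : measurableType dT}
  (P : probability T R) (Ix : finType) (Z : Ix -> {RV P >-> R}) : Prop :=
  forall B : Ix -> set R, (forall i, measurable (B i)) ->
    P (\bigcap_(i in [set: Ix]) (Z i @^-1` B i)) =
    (\prod_(i : Ix) P (Z i @^-1` B i))%E.

Definition iid_std_gaussian {R : realType} {dT} {T : measurableType dT}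
  (P : probability T R) (Ix : finType) (Z : Ix -> {RV P >-> R}) : Prop :=
  mutually_independent Z /\
  forall i (A : set R), measurable A -> distribution P (Z i) A = normal_prob 0 1 A.

(* Main.v *)
Require Import Defs.
From HB Require Import structures.
From mathcomp Require Import all_boot all_order all_algebra.
From mathcomp Require Import all_classical all_reals all_analysis.
From mathcomp Require Import measurable_realfun ring lra zify.
Import Order.TTheory GRing.Theory Num.Theory.
Import numFieldNormedType.Exports.
Local Open Scope ring_scope.

(** For a competing block J, let D be the number of cells of I outside J. The
score of J exceeds that of I only if a centred Gaussian of variance 2D exceeds
lambda D, which has probability at most exp (- lambda^2 D / 4). Since D is at
least |I_i \ J_i| times the product of the k_z with z <> i, for every mode i, a
large enough signal makes this at most s ^ m, where s = exp (- u) and m is the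
total size of the symmetric differences of the I_i and J_i. Instead of counting
blocks at each distance, the union bound is summed exactly, over all tuples of
subsets: the sum of s ^ m over J <> I is (1 + s) ^ (n_1 + ... + n_d) - 1. *)

(** * Subset sums and the combinatorics of blocks *)

Lemma sum_expr_card {R : comNzRingType} (T : finType) (s : R) :
  \sum_(S : {set T}) s ^+ #|S| = (1 + s) ^+ #|T|.
Proof.
(* When the product of the factors [s + 1] is expanded, a subset records which factors contribute
   [s]. *)
rewrite addrC -[RHS]prodr_const bigA_distr.
apply: eq_bigr => S _; rewrite [RHS](bigID (mem S))/=.
rewrite [X in _ = _ * X]big1 ?mulr1; last by move=> i /negbTE ->.
by rewrite -prodr_const; apply: eq_bigr => i ->.
Qed.

(** Induction on [m]: the bound on [s * m] keeps the cross term [2 * s ^ 2 * m] below [s], so each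
    new factor adds at most [2 * s]. *)
Lemma expr1D_le {R : realFieldType} (s : R) (m : nat) :
  0 <= s -> 2 * (s * m%:R) <= 1 -> (1 + s) ^+ m <= 1 + 2 * (s * m%:R).
Proof.
move=> s0; elim: m => [|m IH] H; first by rewrite expr0 mulr0 mulr0 addr0.
have {}IH : (1 + s) ^+ m <= 1 + 2 * (s * m%:R).
  by apply: IH; move: H; rewrite -natr1; nra.
have m0 : 0 <= m%:R :> R by [].
rewrite exprS; move: H; rewrite -natr1 => H.
by apply: (le_trans (ler_wpM2l _ IH)); nra.
Qed.

Section blocks.
Context {d : nat} (n : 'I_d -> nat).
Implicit Types I J : supp n.
Local Notation cell := {i : 'I_d & 'I_(n i)}.

(** The modes are glued into one disjoint union, so that a tuple of subsets becomes a single subset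
    and the binomial identity applies directly. *)
Definition supp_symdiff I J : {set cell} :=
  [set p | (tagged p \in I (tag p)) != (tagged p \in J (tag p))].

Let flip I (S : {set cell}) : supp n :=
  [ffun i => [set x | (x \in I i) != (Tagged (fun i => 'I_(n i)) x \in S)]].

Let supp_symdiff_bij I : bijective (supp_symdiff I).
Proof.
exists (flip I) => [J|S].
  by apply/ffunP => i; apply/setP => x; rewrite ffunE !inE/=; do 2 case: (_ \in _).
by apply/setP => -[i x]; rewrite !inE/= ffunE inE; do 2 case: (_ \in _).
Qed.

Lemma supp_symdiff_eq0 I J : (supp_symdiff I J == finset.set0) = (J == I).
Proof.
rewrite -(inj_eq (bij_inj (supp_symdiff_bij I))); congr (_ == _).
by apply/setP => p; rewrite !inE eqxx.
Qed.

Lemma card_cell : #|{: cell}| = (\sum_i n i)%N.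
Proof.
by rewrite card_tagged sumnE big_map big_enum; apply: eq_bigr => i _; rewrite card_ord.
Qed.

Lemma sum_expr_symdiff {R : comNzRingType} (s : R) I :
  \sum_(J : supp n | J != I) s ^+ #|supp_symdiff I J| = (1 + s) ^+ (\sum_i n i)%N - 1.
Proof.
rewrite -card_cell -sum_expr_card (bigD1 finset.set0)//=.
rewrite cards0 expr0 addrAC subrr add0r.
rewrite [RHS](reindex (supp_symdiff I)); last exact/onW_bij/supp_symdiff_bij.
by apply: eq_bigl => J; rewrite supp_symdiff_eq0.
Qed.

(** In each mode the two sets have the same size, so their one-sided differences do too. *)
Lemma card_supp_symdiff (k : 'I_d -> nat) I J : admissible k I -> admissible k J ->
  #|supp_symdiff I J| = (2 * \sum_i #|I i :\: J i|)%N.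
Proof.
move=> kI kJ; rewrite -sum1_card big_distrr/=.
transitivity (\sum_i \sum_(x in 'I_(n i) | (x \in I i) != (x \in J i)) 1)%N.
  rewrite sig_big_dep/=; apply: eq_bigl => p; by rewrite !inE.
apply: eq_bigr => i _.
have E : #|I i :\: J i| = #|J i :\: I i|.
  by rewrite !cardsD kI kJ finset.setIC.
rewrite mul2n -addnn {2}E -cardsUI.
rewrite (_ : (_ :&: _) = finset.set0) ?cards0 ?addn0; last first.
  by apply/setP => x; rewrite !inE; do 2 case: (_ \in _).
rewrite -sum1_card; apply: eq_bigl => x; rewrite !inE.
by do 2 case: (_ \in _).
Qed.

Definition block_diff I J : {set tidx n} := [set x | in_block I x && ~~ in_block J x].

Lemma card_in_block I : #|[set x | in_block I x]| = (\prod_i #|I i|)%N.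
Proof. by rewrite -cardsXn; apply: eq_card => x; rewrite !inE. Qed.

(** A cell of I whose i-th coordinate lies outside [J i] is outside the block of J; such cells form
    the product set [A]. *)
Lemma card_block_diff_ge I J i :
  (#|I i :\: J i| * \prod_(z < d | z != i) #|I z| <= #|block_diff I J|)%N.
Proof.
pose A z := if z == i then I z :\: J z else I z.
have -> : (#|I i :\: J i| * \prod_(z < d | z != i) #|I z| = \prod_z #|A z|)%N.
  rewrite [RHS](bigD1 i)//= /A eqxx; congr muln.
  by apply: eq_bigr => z /negbTE ->.
rewrite -cardsXn; apply/subset_leq_card/fintype.subsetP => x /setXnP xA.
rewrite inE; apply/andP; split.
  apply/forallP => z; have := xA z; rewrite /A; case: ifP => // _.
  by rewrite inE => /andP[].
apply/negP => /forallP /(_ i) xJ; have := xA i.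
by rewrite /A eqxx inE xJ.
Qed.

Lemma card_block_diffC (k : 'I_d -> nat) I J : admissible k I -> admissible k J ->
  #|block_diff I J| = #|block_diff J I|.
Proof.
move=> kI kJ.
have E (I' J' : supp n) : block_diff I' J' =
    [set x | in_block I' x] :\: [set x | in_block J' x].
  by apply/setP => x; rewrite !inE andbC.
rewrite !E !cardsD !card_in_block finset.setIC; congr subn.
by apply: eq_bigr => i _; rewrite kI kJ.
Qed.

End blocks.

Local Open Scope classical_set_scope.
Local Open Scope ring_scope.

(** * Integrals of independent products *)

Section integral_transfer.
Import HBNNSimple.

(** Monotone approximation by simple functions. The weight [W] serves two purposes: it is a density
    when a law is given by one, and the product of the other factors when variables are
    independent. *)
Lemma integral_comp_mul_of_indic {R : realType} {dT dU}
    {T : measurableType dT} {U : measurableType dU}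
    (mu : {measure set T -> \bar R}) (nu : {measure set U -> \bar R})
    (X : T -> U) (W : T -> R) (c : R) :
  measurable_fun setT X -> measurable_fun setT W -> (forall w, 0 <= W w) ->
  (forall B : set U, measurable B ->
    (\int[mu]_w (\1_B (X w) * W w)%:E = c%:E * nu B)%E) ->
  forall f : U -> R, measurable_fun [set: U] f -> (forall x, 0 <= f x) ->
  (\int[mu]_w (f (X w) * W w)%:E = c%:E * \int[nu]_x (f x)%:E)%E.
Proof.
move=> mX mW W0 H f mf f0.
have mEf : measurable_fun [set: U] (EFin \o f) by exact/measurable_EFinP.
pose h := nnsfun_approx measurableT mEf.
have hcvg x : (h n x)%:E @[n --> \oo] --> (f x)%:E.
  by apply: (cvg_nnsfun_approx measurableT mEf) => // y _; rewrite lee_fin.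
have nd_h x : {homo (fun n => h n x) : m n / (m <= n)%N >-> m <= n}.
  by move=> m n mn; exact/lefP/nd_nnsfun_approx.
have mhX n : measurable_fun setT (fun w => h n (X w)) by exact: measurableT_comp.
have E1 : (\int[nu]_x (f x)%:E = limn (fun n => \int[nu]_x (h n x)%:E))%E.
  rewrite -monotone_convergence//.
  - by apply: eq_integral => x _; apply/esym/cvg_lim => //; exact: hcvg.
  - by move=> n; exact/measurable_EFinP.
  - by move=> n w _; rewrite lee_fin.
  - by move=> w _ m n mn; rewrite lee_fin nd_h.
have E2 : (\int[mu]_w (f (X w) * W w)%:E =
    limn (fun n => \int[mu]_w (h n (X w) * W w)%:E))%E.
  rewrite -monotone_convergence//.
  - apply: eq_integral => w _; apply/esym/cvg_lim => //.
    under eq_fun do rewrite EFinM.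
    by rewrite EFinM; apply: cvgeZr => //; exact: hcvg.
  - by move=> n; apply/measurable_EFinP; exact: measurable_funM.
  - by move=> n w _; rewrite lee_fin mulr_ge0.
  - by move=> w _ m n mn; rewrite lee_fin ler_wpM2r// nd_h.
have cvgI : cvgn (fun n => \int[nu]_x (h n x)%:E)%E.
  apply: ereal_nondecreasing_is_cvgn => m n mn; apply: ge0_le_integral => //;
    try exact/measurable_EFinP; by move=> w _; rewrite lee_fin// nd_h.
rewrite E1 E2 -limeMl//; apply: congr_lim; apply/funext => n.
have mI r : measurable (h n @^-1` [set r]) by [].
have m1 r : measurable_fun setT (fun w => \1_(h n @^-1` [set r]) (X w) : R).
  by apply: measurableT_comp => //; exact: measurable_indic.
have h0 r : r \in range (h n) -> 0 <= r by rewrite inE => -[x _ <-].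
rewrite integralT_nnsfun sintegralE ge0_mule_fsumr; last first.
  by move=> r; exact: nnsfun_mulemu_ge0.
(* The simple function is split over its finitely many values, and the hypothesis applies to each
   level set. *)
transitivity (\int[mu]_w (\sum_(r \in range (h n))
    (r * \1_(h n @^-1` [set r]) (X w) * W w)%:E))%E.
  apply: eq_integral => w _; rewrite fsumEFin// fimfunE.
  by congr EFin; rewrite !fsbig_finite//= mulr_suml.
rewrite ge0_integral_fsum//.
- apply: eq_fsbigr => r /h0 r0.
  under eq_integral do rewrite -mulrA EFinM.
  rewrite ge0_integralZl_EFin//.
  + by rewrite H// muleCA.
  + by move=> w _; rewrite lee_fin mulr_ge0.
  + by apply/measurable_EFinP; exact: measurable_funM.
- by move=> r; apply/measurable_EFinP; do 2 apply: measurable_funM => //.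
- move=> r w _; rewrite lee_fin mulr_ge0// -lee_fin EFinM.
  exact: nnfun_muleindic_ge0.
Qed.

End integral_transfer.

Section independent_products.
Context {R : realType} {dT} {T : measurableType dT} (P : probability T R).

Lemma integral_prod_independent (Ix : finType) (Z : Ix -> {RV P >-> R})
    (f : Ix -> R -> R) (m : Ix -> R) :
  mutually_independent Z ->
  (forall i, measurable_fun [set: R] (f i)) -> (forall i x, 0 <= f i x) ->
  (forall i, \int[P]_w (f i (Z i w))%:E = (m i)%:E)%E ->
  (\int[P]_w (\prod_i f i (Z i w))%:E = (\prod_i m i)%:E)%E.
Proof.
move=> indep.
(* Indicators are turned into arbitrary functions one index at a time. *)
suff H (r : seq Ix) : forall (f : Ix -> R -> R) (m : Ix -> R),
    (forall i, measurable_fun [set: R] (f i)) -> (forall i x, 0 <= f i x) ->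
    (forall i, \int[P]_w (f i (Z i w))%:E = (m i)%:E)%E ->
    (forall i, i \notin r -> exists B : set R, measurable B /\ f i = \1_B) ->
    (\int[P]_w (\prod_i f i (Z i w))%:E = (\prod_i m i)%:E)%E.
  move=> mf f0 fm; apply: (H (enum Ix)) => // i.
  by rewrite mem_enum.
elim: r => [|a r IH] {}f {}m mf f0 fm fB.
  have /choice[B HB] : forall i, exists B : set R, measurable B /\ f i = \1_B.
    by move=> i; exact: fB.
  have mB i : measurable (B i) by have [] := HB i.
  have mZB i : measurable (Z i @^-1` B i).
    by rewrite -[X in measurable X]setTI; exact: measurable_funP.
  (* With only indicators left, the product is the indicator of an intersection, and independence is
     exactly the claim. *)
  have E w : \prod_i f i (Z i w) =
      \1_(\bigcap_(i in [set: Ix]) (Z i @^-1` B i)) w :> R.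
    rewrite indicE; case: (boolP (w \in _)) => [|/negP]; rewrite inE => wB.
      apply: big1 => i _; have [_ ->] := HB i.
      by rewrite indicE mem_set//; exact: (wB i).
    have [i wBi] : exists i, ~ B i (Z i w).
      by apply/existsNP => K; apply: wB => i _; exact: K.
    rewrite (bigD1 i)//=; have [_ ->] := HB i.
    by rewrite indicE memNset// mul0r.
  under eq_integral do rewrite E.
  rewrite integral_indic//; last by apply: fin_bigcap_measurable => // i _.
  rewrite setIT; apply: (etrans (indep B mB)); rewrite -prodEFin; apply: eq_bigr => i _.
  rewrite -fm; have [_ ->] := HB i.
  by rewrite (_ : (fun w => _) = (fun w => (\1_(Z i @^-1` B i) w)%:E))//
     integral_indic// setIT.
(* The other factors are frozen into a weight, so it suffices to treat an indicator in place of
   [f a]. *)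
pose W w := \prod_(i | i != a) f i (Z i w).
have mW : measurable_fun setT W.
  have -> : W = fun w => \prod_i (if i != a then f i (Z i w) else 1).
    by apply/funext => w; rewrite /W [LHS]big_mkcond.
  apply: measurable_prod => i _; case: (i != a) => //.
  exact: measurableT_comp.
have fW w : \prod_i f i (Z i w) = f a (Z a w) * W w by rewrite (bigD1 a).
under eq_integral do rewrite fW.
rewrite [in RHS](bigD1 a)//= EFinM muleC -fm.
have fD : (\int[P]_w (f a (Z a w))%:E = \int[distribution P (Z a)]_x (f a x)%:E)%E.
  rewrite ge0_integral_distribution//; first exact/measurable_EFinP.
  by move=> x; rewrite lee_fin.
rewrite fD; apply: integral_comp_mul_of_indic => // [w|B mB].
  by rewrite /W prodr_ge0.
(* With an indicator at [a], that index leaves the list of general functions and the induction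
   hypothesis applies. *)
pose g i := if i == a then \1_B else f i.
pose p i := if i == a then fine (P (Z a @^-1` B)) else m i.
have IB : (\int[P]_w (\1_B (Z a w))%:E = P (Z a @^-1` B))%E.
  rewrite (_ : (fun w => _) = (fun w => (\1_(Z a @^-1` B) w)%:E))//.
  rewrite integral_indic// ?setIT//.
  by rewrite -[X in measurable X]setTI; exact: measurable_funP.
have gW w : \prod_i g i (Z i w) = \1_B (Z a w) * W w.
  rewrite (bigD1 a)//= /g eqxx; congr (_ * _).
  by apply: eq_bigr => i /negbTE ->.
have pW : ((\prod_i p i)%:E = (\prod_(i | i != a) m i)%:E * P (Z a @^-1` B))%E.
  rewrite (bigD1 a)//= {1}/p eqxx EFinM fineK ?fin_num_measure//; last first.
    by rewrite -[X in measurable X]setTI; exact: measurable_funP.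
  by rewrite muleC; congr (_%:E * _)%E; apply: eq_bigr => i /negbTE ia; rewrite /p ia.
rewrite -pW -(IH g p).
- by apply: eq_integral => w _; rewrite gW.
- by move=> i; rewrite /g; case: ifP => // _; exact: measurable_indic.
- by move=> i x; rewrite /g; case: ifP.
- move=> i; rewrite /g /p; case: eqP => [->|//].
  rewrite IB fineK// fin_num_measure//.
  by rewrite -[X in measurable X]setTI; exact: measurable_funP.
- move=> i ir; rewrite /g; case: eqP => [ia|ia]; first by exists B.
  by apply: fB; rewrite inE negb_or ir andbT; apply/eqP.
Qed.

End independent_products.

(** * Gaussian moment generating function and tail bound *)

Lemma integral_expR_normal {R : realType} (t : R) :
  (\int[normal_prob 0 1]_(x in [set: R]) (expR (t * x))%:E = (expR (t ^+ 2 / 2))%:E)%E.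
Proof.
have m1 : measurable_fun [set: R] (fun x : R => expR (t * x)).
  by apply: measurableT_comp => //; exact: measurable_funM.
(* Completing the square: the exponential tilt shifts the mean of the density to [t]. *)
have H (x : R) : expR (t * x) * normal_pdf 0 1 x =
    expR (t ^+ 2 / 2) * normal_pdf t 1 x.
  rewrite !normal_pdfE//= mulrCA [in RHS]mulrCA /normal_fun -!expRD.
  by congr (_ * expR _); field.
rewrite -[LHS]mul1e.
rewrite -(@integral_comp_mul_of_indic R _ _ (measurableTypeR R)
  (measurableTypeR R) lebesgue_measure (@normal_prob R 0 1) id
  (normal_pdf 0 1) 1)//.
- under eq_integral do rewrite /= H EFinM.
  rewrite ge0_integralZl_EFin//.
  + by rewrite integral_normal_pdf mule1.
  + by move=> x _; rewrite lee_fin normal_pdf_ge0.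
  + by apply/measurable_EFinP; exact: measurable_normal_pdf.
- exact: measurable_normal_pdf.
- by move=> x; exact: normal_pdf_ge0.
- move=> B mB; rewrite mul1e /normal_prob [RHS]integral_mkcond.
  apply: eq_integral => x _; rewrite patchE indicE.
  by case: ifP => _; rewrite ?mul1r ?mul0r.
Qed.

Section gaussian_tail.
Context {R : realType} {dT} {T : measurableType dT} (P : probability T R).
Context (Ix : finType) (Z : Ix -> {RV P >-> R}).
Hypothesis iidZ : iid_std_gaussian Z.

Lemma integral_expR_gaussian (i : Ix) (t : R) :
  (\int[P]_w (expR (t * Z i w))%:E = (expR (t ^+ 2 / 2))%:E)%E.
Proof.
have m1 : measurable_fun [set: R] (fun x : R => expR (t * x)).
  by apply: measurableT_comp => //; exact: measurable_funM.
rewrite -integral_expR_normal -[RHS]mul1e.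
rewrite -(@integral_comp_mul_of_indic R _ _ T (measurableTypeR R) P
  (@normal_prob R 0 1) (Z i) (cst 1) 1)//.
- by apply: eq_integral => w _; rewrite /= mulr1.
- by move=> mT B mB; exact: (measurable_funP (Z i)).
- move=> B mB; have [_ ZN] := iidZ.
  under eq_integral do rewrite /= mulr1.
  rewrite mul1e (_ : (fun w => _) = (fun w => (\1_(Z i @^-1` B) w)%:E))//.
  rewrite integral_indic// ?setIT//; first exact: (ZN i B mB).
  by rewrite -[X in measurable X]setTI; exact: (measurable_funP (Z i)).
Qed.

Lemma measurable_lincomb (c : Ix -> R) :
  measurable_fun setT (fun w => \sum_i c i * Z i w).
Proof. by apply: measurable_sum => i; exact: measurable_funM. Qed.

Lemma measurable_lincomb_ge (c : Ix -> R) (a : R) :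
  measurable [set w | a <= \sum_i c i * Z i w].
Proof.
rewrite (_ : [set _ | _] =
    [set: T] `&` (fun w => \sum_i c i * Z i w) @^-1` `[a, +oo[).
  by apply: measurable_lincomb => //; exact: measurable_itv.
by apply/seteqP; split => w /=; rewrite in_itv/= andbT // => -[].
Qed.

Lemma gaussian_lincomb_tail (c : Ix -> R) (a v : R) :
  0 <= a -> 0 < v -> \sum_i c i ^+ 2 = v ->
  (P [set w | a <= \sum_i c i * Z i w]%R <= (expR (- (a ^+ 2 / (2 * v))))%:E)%E.
Proof.
move=> a0 v0 cv; have [{a0}a0|] := ltP 0 a; last first.
  move=> a1; have -> : a = 0 by apply/le_anti/andP.
  by rewrite expr0n mul0r oppr0 expR0 probability_le1//; exact: measurable_lincomb_ge.
pose X : {RV P >-> R} := mfun_Sub (mem_set (measurable_lincomb c)).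
(* The parameter [r = a / v] minimises the exponent [r ^ 2 * v / 2 - r * a]. *)
have r0 : 0 < a / v by exact: divr_gt0.
have XE : [set w | a <= \sum_i c i * Z i w] = [set w | a <= X w] by [].
have ch := @chernoff _ _ _ P X _ a r0; rewrite XE; apply: (le_trans ch).
have -> : ('M_P X (a / v) = (expR ((a / v) ^+ 2 * v / 2))%:E)%E.
  rewrite /mmt_gen_fun unlock.
  have E w : expR (X w * (a / v)) = \prod_i expR (a / v * c i * Z i w).
    rewrite -expR_sum mulr_suml; congr expR; apply: eq_bigr => i _.
    by rewrite mulrC mulrA.
  under eq_integral do rewrite /= E.
  rewrite (integral_prod_independent P Ix Z (fun i x => expR (a / v * c i * x))
    (fun i => expR ((a / v * c i) ^+ 2 / 2))).
  - rewrite -expR_sum -cv mulr_sumr mulr_suml; congr (expR _)%:E.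
    by apply: eq_bigr => i _; rewrite exprMn.
  - by case: iidZ.
  - by move=> i; apply: measurableT_comp => //; exact: measurable_funM.
  - by move=> i x; exact: expR_ge0.
  - by move=> i; exact: integral_expR_gaussian.
rewrite -EFinM -expRD lee_fin ler_expR le_eqVlt; apply/orP; left; apply/eqP.
by field; rewrite gt_eqF.
Qed.

End gaussian_tail.

(** * Union bound over competing blocks *)

Lemma probability_bigcup_finite_le {R : realType} {dT} {T : measurableType dT}
    (P : probability T R) (I : Type) (s : seq I) (Q : pred I) (E : I -> set T)
    (b : I -> R) :
  (forall i, measurable (E i)) -> (forall i, Q i -> (P (E i) <= (b i)%:E)%E) ->
  (P (\big[setU/set0]_(i <- s | Q i) E i) <= (\sum_(i <- s | Q i) b i)%:E)%E.
Proof.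
move=> mE Eb; elim: s => [|i s IH]; first by rewrite !big_nil measure0.
rewrite !big_cons; case: ifP => // Qi.
apply: (le_trans (measureU2 _ _ _)) => //; first exact: bigsetU_measurable.
by rewrite EFinD leeD// Eb.
Qed.

Section recovery.
Context {R : realType} {d : nat} (n k : 'I_d -> nat).
Implicit Types I J : supp n.

(** Coefficients of the score difference as a linear form in the data; the cells common to both
    blocks cancel. *)
Definition contrast I J (x : tidx n) : R := (in_block J x)%:R - (in_block I x)%:R.

Lemma block_score_contrast (Y : tidx n -> R) I J :
  block_score Y J - block_score Y I = \sum_x contrast I J x * Y x.
Proof.
rewrite /block_score !(big_mkcond (in_block _))/= -sumrB.
apply: eq_bigr => x _; rewrite /contrast mulrBl.
by case: (in_block J x); case: (in_block I x) => /=; ring.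
Qed.

Lemma sum_contrast_sqr I J : admissible k I -> admissible k J ->
  \sum_x contrast I J x ^+ 2 = 2 * #|block_diff n I J|%:R.
Proof.
move=> kI kJ.
rewrite mulrDl mul1r {2}(card_block_diffC n k I J kI kJ) -!sum1_card !natr_sum.
rewrite !(big_mkcond (fun x => x \in _))/= -big_split/=.
apply: eq_bigr => x _; rewrite !inE /contrast.
by case: (in_block J x); case: (in_block I x) => /=; ring.
Qed.

Lemma sum_contrast_block_tensor (lam : R) I J :
  \sum_x contrast I J x * block_tensor lam I x = - (lam * #|block_diff n I J|%:R).
Proof.
rewrite -sum1_card natr_sum mulr_sumr -sumrN [RHS]big_mkcond/=.
apply: eq_bigr => x _; rewrite !inE /contrast /block_tensor.
by case: (in_block J x); case: (in_block I x) => /=; ring.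
Qed.

(** The cell count is bounded below once per mode, and the [d] bounds are added. In [8 * d], a
    factor 2 comes from the two-sided difference, 4 from the Gaussian exponent and [d] from the
    addition. *)
Lemma card_block_diff_symdiff_ge (lam u : R) I J :
  (0 < d)%N -> admissible k I -> admissible k J ->
  (forall i, 8 * d%:R * u <= lam ^+ 2 * (\prod_(z < d | z != i) (k z)%:R)) ->
  u * #|supp_symdiff n I J|%:R <= lam ^+ 2 * #|block_diff n I J|%:R / 4.
Proof.
move=> d0 kI kJ H.
rewrite (card_supp_symdiff n k I J kI kJ) natrM natr_sum.
have d0R : 0 < d%:R :> R by rewrite ltr0n.
suff K : 8 * d%:R * u * (\sum_i #|I i :\: J i|%:R) <=
    d%:R * (lam ^+ 2 * #|block_diff n I J|%:R).
  rewrite -(ler_pM2l d0R); move: K; set a := \sum_i _; set b := #|_|%:R; nra.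
rewrite mulr_sumr.
have -> : d%:R * (lam ^+ 2 * #|block_diff n I J|%:R) =
    \sum_(i < d) (lam ^+ 2 * #|block_diff n I J|%:R) :> R.
  by rewrite sumr_const card_ord mulr_natl.
apply: ler_sum => i _; apply: (le_trans (ler_wpM2r _ (H i))) => //.
rewrite -mulrA ler_wpM2l ?sqr_ge0// mulrC -natr_prod -natrM ler_nat.
apply: leq_trans (card_block_diff_ge n I J i).
by rewrite leq_mul2l; apply/orP; right; apply: leq_prod => z _; rewrite kI.
Qed.

(** Gives the Gaussian tail bound its positive variance. An empty difference would force every
    [I i :\: J i] to be empty, hence J = I since sizes agree. *)
Lemma block_diff_gt0 I J : (forall i, 0 < k i)%N -> admissible k I ->
  admissible k J -> J != I -> (0 < #|block_diff n I J|)%N.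
Proof.
move=> k0 kI kJ; apply: contraR; rewrite -leqNgt leqn0 => /eqP D0.
rewrite -supp_symdiff_eq0 -cards_eq0 (card_supp_symdiff n k I J kI kJ).
rewrite big1 ?muln0// => i _.
have := card_block_diff_ge n I J i; rewrite D0 leqn0 muln_eq0 => /orP[/eqP//|].
have -> : (\prod_(z < d | z != i) #|I z| == 0)%N = false => //.
apply/negbTE; rewrite -lt0n prodn_cond_gt0// => z _.
by rewrite kI.
Qed.

Lemma block_recovery_probability {dT} {T : measurableType dT}
    (P : probability T R) (Z : tidx n -> {RV P >-> R}) (lam u : R) I :
  (0 < d)%N -> iid_std_gaussian Z -> admissible k I -> (forall i, 0 < k i)%N ->
  0 <= lam ->
  (forall i, 8 * d%:R * u <= lam ^+ 2 * (\prod_(z < d | z != i) (k z)%:R)) ->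
  2 * (expR (- u) * (\sum_i n i)%:R) <= 1 ->
  exists A : set T, measurable A /\
    A `<=` [set w | unique_argmax k (fun x => block_tensor lam I x + Z x w) I] /\
    ((1 - 2 * (expR (- u) * (\sum_i n i)%:R))%:E <= P A)%E.
Proof.
move=> d0 iidZ kI k0 lam0 lamu M1.
(* The noise makes up for the signal that J loses on the cells of I it misses. *)
pose bad J := [set w | lam * #|block_diff n I J|%:R <=
  \sum_x contrast I J x * Z x w].
pose adm J := [forall i, #|J i| == k i].
have admP J : adm J -> admissible k J by move=> /forallP H i; exact/eqP.
have mbad J : measurable (bad J) by exact: measurable_lincomb_ge.
exists (~` \big[setU/set0]_(J : supp n | adm J && (J != I)) bad J).
have mU : measurable (\big[setU/set0]_(J : supp n | adm J && (J != I)) bad J).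
  by apply: bigsetU_measurable => J _.
split; first exact: measurableC.
split.
  move=> w Aw J kJ JI; rewrite -subr_lt0 block_score_contrast.
  under eq_bigr do rewrite mulrDr.
  rewrite big_split/= sum_contrast_block_tensor addrC subr_lt0 ltNge.
  apply/negP => badw; apply: Aw.
  rewrite (bigD1 J)/=; first by left.
  by rewrite JI andbT; apply/forallP => i; rewrite kJ.
rewrite probability_setC// EFinB leeB//.
apply: (le_trans (probability_bigcup_finite_le P _ _ _ bad
  (fun J => expR (- u) ^+ #|supp_symdiff n I J|) mbad _)) => [J /andP[/admP kJ JI]|].
  have D0 : 0 < #|block_diff n I J|%:R :> R by rewrite ltr0n block_diff_gt0.
  apply: (le_trans (gaussian_lincomb_tail P _ Z iidZ (contrast I J) _ _ _ _
    (sum_contrast_sqr I J kI kJ))).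
  - by rewrite mulr_ge0.
  - by rewrite mulr_gt0.
  (* With [a = lam * D] and [v = 2 * D], the exponent [a ^ 2 / (2 * v)] is [lam ^ 2 * D / 4]. *)
  - rewrite lee_fin -expRM_natl ler_expR mulrN lerN2 mulrC.
    apply: (le_trans (card_block_diff_symdiff_ge lam u I J d0 kI kJ lamu)).
    rewrite le_eqVlt; apply/orP; left; apply/eqP.
    by field; rewrite gt_eqF.
rewrite lee_fin.
(* Adding the nonnegative terms of inadmissible J gives the sum its closed form. *)
apply: (@le_trans _ _ (\sum_(J : supp n | J != I) expR (- u) ^+ #|supp_symdiff n I J|)).
  rewrite [leRHS](bigID adm)/= [X in X + _](eq_bigl (fun J => adm J && (J != I))).
    by rewrite lerDl sumr_ge0// => J _; rewrite exprn_ge0// expR_ge0.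
  by move=> J; rewrite andbC.
rewrite sum_expr_symdiff lerBlDl; exact: expr1D_le.
Qed.

End recovery.

(** * Finite-sample bounds for the two regimes *)

Section regimes.
Context {R : realType} {d : nat}.

Lemma unique_argmax_dim0 (n k : 'I_d -> nat) (Y : tidx n -> R) (I : supp n) :
  d = 0%N -> unique_argmax k Y I.
Proof.
by move=> d0 J _ /eqP[]; apply/ffunP => i; move: (ltn_ord i); rewrite {2}d0.
Qed.

(** Take [u = 2 * L]: then [expR (- u)] is at most [(p i)^-1 ^+ 2] for every i, while
    [n i <= 2 * p i], so the failure bound is at most 4 times the sum of the [(p i)^-1]. The
    condition [8 * d <= n i] keeps this below 1. *)
Lemma block_recovery_snr {dT} {T : measurableType dT} (P : probability T R)
    (n k : 'I_d -> nat) (Z : tidx n -> {RV P >-> R}) (lam : R) (I : supp n) :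
  (0 < d)%N -> iid_std_gaussian Z -> admissible k I -> (forall i, 0 < k i)%N ->
  (forall i, 2 * k i <= n i)%N -> (forall i, 8 * d <= n i)%N ->
  (forall i, 4 * (d%:R + 1) * Num.sqrt ((\sum_(j < d) ln ((n j - k j)%:R : R)) /
                     (\prod_(z < d | z != i) (k z)%:R)) <= lam) ->
  exists A : set T, measurable A /\
    A `<=` [set w | unique_argmax k (fun x => block_tensor lam I x + Z x w) I] /\
    ((1 - 4 * \sum_(i < d) ((n i - k i)%:R : R) `^ (- 1))%:E <= P A)%E.
Proof.
move=> d0 iidZ kI k0 kn dn lamL; set L := \sum_(j < d) _ in lamL.
pose p i : R := (n i - k i)%:R.
have d1 : 1 <= d%:R :> R by rewrite ler1n.
have p4 i : 4 * d%:R <= p i.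
  by rewrite /p -natrM ler_nat; have := kn i; have := dn i; lia.
have np i : (n i)%:R <= 2 * p i.
  by rewrite /p -natrM ler_nat; have := kn i; lia.
have p0 i : 0 < p i by apply: lt_le_trans (p4 i); lra.
have lnp0 i : 0 <= ln (p i) by apply: ln_ge0; apply: le_trans (p4 i); lra.
have L0 : 0 <= L by apply: sumr_ge0 => j _; exact: lnp0.
have eL i : expR (- (2 * L)) <= (p i)^-1 ^+ 2.
  rewrite -[p i]lnK ?posrE// -expRN -expRM_natl ler_expR mulrN lerN2.
  rewrite ler_wpM2l// /L (bigD1 i)//= lerDl sumr_ge0// => j _; exact: lnp0.
have lam0 : 0 <= lam.
  by apply: le_trans (lamL (Ordinal d0)); rewrite mulr_ge0// ?sqrtr_ge0//; lra.
have M : expR (- (2 * L)) * (\sum_i n i)%:R <= 2 * \sum_(i < d) (p i)^-1.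
  rewrite natr_sum mulr_sumr [leRHS]mulr_sumr ler_sum// => i _.
  apply: (le_trans (ler_pM (expR_ge0 _) (ler0n _ _) (eL i) (np i))).
  rewrite le_eqVlt; apply/orP; left; apply/eqP; field.
  by rewrite gt_eqF// p0.
have S : 4 * \sum_(i < d) (p i)^-1 <= 1.
  rewrite mulr_sumr; apply: (@le_trans _ _ (\sum_(i < d) d%:R^-1)).
    apply: ler_sum => i _.
    rewrite ler_pdivrMr// mulrC ler_pdivlMr ?p4//; lra.
  by rewrite sumr_const card_ord -[_ *+ d]mulr_natl mulfV// gt_eqF//; lra.
have [||A [mA [sA PA]]] := @block_recovery_probability R d n k
    _ _ P Z lam (2 * L) I d0 iidZ kI k0 lam0.
- move=> i; have K0 : 0 < \prod_(z < d | z != i) (k z)%:R :> R.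
    by apply: prodr_gt0 => z _; rewrite ltr0n.
  have Q0 : 0 <= L / \prod_(z < d | z != i) (k z)%:R by rewrite divr_ge0// ltW.
  rewrite -ler_pdivrMr//.
  apply: (@le_trans _ _ ((4 * (d%:R + 1) *
      Num.sqrt (L / \prod_(z < d | z != i) (k z)%:R)) ^+ 2)).
    (* The required factor is [8 * d * 2 = 16 * d], which the square of [4 * (d + 1)] dominates. *)
    rewrite exprMn sqr_sqrtr// (_ : _ / _ =
      16 * d%:R * (L / \prod_(z < d | z != i) (k z)%:R)); last by ring.
    by rewrite ler_wpM2r//; nra.
  by rewrite ler_sqr ?nnegrE ?lamL// mulr_ge0// ?sqrtr_ge0//; lra.
- lra.
exists A; split => //; split => //; apply: le_trans PA.
rewrite lee_fin lerD2l lerN2.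
rewrite (eq_bigr (fun i => (p i)^-1)); last by move=> i _; rewrite powR_inv1// ltW.
lra.
Qed.

Lemma sqr_half_le_expR (x : R) : 0 <= x -> (x / 2) ^+ 2 <= expR x.
Proof.
move=> x0; have -> : expR x = expR (x / 2) ^+ 2.
  by rewrite -expRM_natl; congr expR; field.
have := expR_ge1Dx (x / 2); have := expR_ge0 (x / 2).
rewrite ler_sqr ?nnegrE ?expR_ge0//; lra.
Qed.

(* [t] plays the role of log n: the squared signal-to-noise ratio is at least
   exp (dl * t / 2), so the failure probability is doubly exponentially small. *)
Lemma block_recovery_exponent {dT} {T : measurableType dT} (P : probability T R)
    (N k : nat) (Z : tidx (fun _ : 'I_d => N) -> {RV P >-> R})
    (lam lam' dl t eps : R) (I : supp (fun _ : 'I_d => N)) :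
  (0 < d)%N -> iid_std_gaussian Z -> admissible (fun _ => k) I -> (0 < k)%N ->
  0 < lam -> lam <= lam' -> 0 < dl -> 0 < eps -> 0 < t ->
  384 * d%:R / dl ^+ 2 <= t -> 2 * d%:R <= t -> 2 * d%:R / eps <= t ->
  ln (N%:R : R) <= 2 * t ->
  dl / 2 * t <= (d%:R - 1) * ln (k%:R : R) - 2 * ln (lam^-1) ->
  exists A : set T, measurable A /\
    A `<=` [set w | unique_argmax (fun _ => k)
                      (fun x => block_tensor lam' I x + Z x w) I] /\
    ((1 - eps)%:E <= P A)%E.
Proof.
move=> d0 iidZ kI k0 lam0 lamlam' dl0 eps0 t0 t1 t2 t3 Nt snr.
have d1 : 1 <= d%:R :> R by rewrite ler1n.
pose S := lam ^+ 2 * k%:R ^+ d.-1.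
have kR0 : 0 < k%:R :> R by rewrite ltr0n.
have SE : expR (dl / 2 * t) <= S.
  have S0 : 0 < S by rewrite mulr_gt0// exprn_gt0.
  rewrite -[S]lnK ?posrE// ler_expR; apply: (le_trans snr).
  rewrite lnM ?posrE ?exprn_gt0// !lnXn// lnV ?posrE//.
  rewrite -[_ *+ d.-1]mulr_natl -subn1 natrB//; lra.
(* The largest [u] that the signal condition allows at strength [lam]. *)
pose u := S / (8 * d%:R).
(* By [sqr_half_le_expR], [S] is at least [(dl * t / 4) ^ 2]; this exceeds [24 * d * t] once
   [t >= 384 * d / dl ^ 2]. *)
have ut : 3 * t <= u.
  rewrite /u ler_pdivlMr; last lra.
  apply: le_trans SE; apply: le_trans (sqr_half_le_expR _ _); last first.
    by rewrite mulr_ge0// ltW// divr_gt0.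
  move: t1; rewrite ler_pdivrMr ?exprn_gt0// => t1.
  have := ler_wpM2l (ltW t0) t1; nra.
have NE : N%:R <= expR (2 * t).
  have [->|N0] := posnP N; first exact: expR_ge0.
  by rewrite -[leLHS]lnK ?ler_expR// posrE ltr0n.
have sumN : (\sum_(i < d) N)%:R = d%:R * N%:R :> R.
  by rewrite sum_nat_const card_ord natrM.
have uN : expR (- u) * (\sum_(i < d) N)%:R <= d%:R * expR (- t).
  rewrite sumN mulrCA ler_wpM2l//.
  apply: (@le_trans _ _ (expR (- (3 * t)) * expR (2 * t))).
    by rewrite ler_pM ?expR_ge0// ler_expR lerN2.
  by rewrite -expRD ler_expR; lra.
have te := expR_ge1Dx t.
have et : expR (- t) * expR t = 1 by rewrite -expRD addNr expR0.
(* Since [expR t >= 1 + t], the factor [expR (- t)] is at most [1 / t]. Used with [e = 1] for the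
   smallness condition and with [e = eps] for the risk. *)
have bound (e : R) : 0 < e -> 2 * d%:R / e <= t -> 2 * (d%:R * expR (- t)) <= e.
  move=> e0; rewrite ler_pdivrMr// => H.
  have := expR_ge0 (- t); nra.
have [|||A [mA [sA PA]]] := @block_recovery_probability R d (fun _ => N) (fun _ => k)
    _ _ P Z lam' u I d0 iidZ kI (fun=> k0).
- by apply: le_trans lamlam'; exact: ltW.
- move=> i; rewrite prodr_const.
  have -> : #|[pred z : 'I_d | z != i]| = d.-1 by rewrite cardC1 card_ord.
  have -> : 8 * d%:R * u = S by rewrite /u; field; rewrite gt_eqF//; lra.
  rewrite ler_wpM2r ?exprn_ge0//; nra.
- apply: le_trans (bound 1 _ _) => //; last by rewrite divr1.
  by rewrite ler_wpM2l.
exists A; split => //; split => //; apply: le_trans PA.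
rewrite lee_fin lerD2l lerN2; apply: le_trans (bound eps _ _) => //.
by rewrite ler_wpM2l.
Qed.

End regimes.

(** * Passage to the asymptotic statements *)

Theorem mainTheorem2 (R : realType) (d : nat) :
  (* Part 1: regime (A1) *)
  (exists C0 c C : R, 0 < C0 /\ 0 < c /\ 0 < C /\
    forall (n k : nat -> 'I_d -> nat) (lam : nat -> R),
      (forall i, (fun m => ((n m i)%:R : R)) @ \oo --> +oo) ->
      (forall i, (fun m => ((k m i)%:R : R)) @ \oo --> +oo) ->
      (forall i, (fun m => ((k m i)%:R / (n m i)%:R : R)) @ \oo --> 0) ->
      (* lam >= C0 sqrt( sum_i log(n_i - k_i) / min_i prod_{z <> i} k_z ) *)
      (forall m i, C0 * Num.sqrt ((\sum_(j < d) ln ((n m j - k m j)%:R : R)) /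
                     (\prod_(z < d | z != i) (k m z)%:R)) <= lam m) ->
      \forall m \near \oo,
        forall dT (T : measurableType dT) (P : probability T R)
               (Z : tidx (n m) -> {RV P >-> R}),
          iid_std_gaussian Z ->
          forall (lam' : R) (I : supp (n m)), lam m <= lam' -> admissible (k m) I ->
          exists A : set T, measurable A /\
            A `<=` [set w | unique_argmax (k m)
                              (fun x => block_tensor lam' I x + Z x w) I] /\
            ((1 - C * \sum_(i < d) ((n m i - k m i)%:R : R) `^ (- c))%:E <= P A)%E)
  /\
  (* Part 2: regime (A2), reliable recovery when beta < (d-1) alpha / 2 *)
  (forall alpha beta : R, 0 <= alpha <= 1 -> beta < (d%:R - 1) * alpha / 2 ->
    forall (N k : nat -> nat) (lam : nat -> R),
      (forall m, (0 < k m)%N) -> (forall m, 0 < lam m) ->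
      (fun m => ln ((N m)%:R : R) / ln (m%:R)) @ \oo --> (1 : R) ->
      (fun m => ln ((k m)%:R : R) / ln (m%:R)) @ \oo --> alpha ->
      (fun m => ln ((lam m)^-1) / ln (m%:R)) @ \oo --> beta ->
      forall eps : R, 0 < eps ->
      \forall m \near \oo,
        forall dT (T : measurableType dT) (P : probability T R)
               (Z : tidx (fun _ : 'I_d => N m) -> {RV P >-> R}),
          iid_std_gaussian Z ->
          forall (lam' : R) (I : supp (fun _ : 'I_d => N m)),
            lam m <= lam' -> admissible (fun _ => k m) I ->
          exists A : set T, measurable A /\
            A `<=` [set w | unique_argmax (fun _ => k m)
                              (fun x => block_tensor lam' I x + Z x w) I] /\
            ((1 - eps)%:E <= P A)%E).
Proof.
split.
  (* Writing [d + 1] rather than [d] keeps the constant positive when [d = 0]. *)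
  exists (4 * (d%:R + 1)), 1, 4; split; first by have := ler0n R d; lra.
  split=> //; split=> // n k lam ny ky kn0 lamL.
  (* For [d = 0] no tuple differs from I, so the whole space serves as the event. *)
  have [d0|d0] := posnP d.
    apply: nearW => m dT T P Z _ lam' I _ _; exists setT; split => //; split.
      by move=> w _; exact: unique_argmax_dim0.
    by rewrite probability_setT lee_fin gerBl mulr_ge0// sumr_ge0.
  have k1 : \forall m \near \oo, forall i, (0 < k m i)%N.
    apply: filter_forall => i; have /cvgryPge/(_ 1) := ky i.
    by apply: filterS => m; rewrite ler1n.
  have n8 : \forall m \near \oo, forall i, (8 * d <= n m i)%N.
    apply: filter_forall => i; have /cvgryPge/(_ (8 * d)%:R) := ny i.
    by apply: filterS => m; rewrite ler_nat.
  have kn2 : \forall m \near \oo, forall i, (k m i)%:R / (n m i)%:R < 2^-1 :> R.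
    by apply: filter_forall => i; apply: cvgr_lt (kn0 i) _ _.
  near=> m => dT T P Z iidZ lam' I lamlam' kI.
  have n8m : forall i, (8 * d <= n m i)%N by near: m.
  apply: block_recovery_snr => //.
  - by near: m.
  - move=> i; have : (k m i)%:R / (n m i)%:R < 2^-1 :> R by move: i; near: m.
    rewrite ltr_pdivrMr; last first.
      by rewrite ltr0n; apply: leq_trans (n8m i); rewrite muln_gt0.
    rewrite mulrC ltr_pdivlMr// -natrM ltr_nat mulnC; exact: ltnW.
  - by move=> i; apply: le_trans lamlam'.
move=> alpha beta _ ab N k lam k0 lam0 cN ck clam eps eps0.
have [d0|d0] := posnP d.
  apply: nearW => m dT T P Z _ lam' I _ _; exists setT; split => //; split.
    by move=> w _; exact: unique_argmax_dim0.
  by rewrite probability_setT lee_fin gerBl ltW.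
have d1 : 1 <= d%:R :> R by rewrite ler1n.
pose dl := (d%:R - 1) * alpha - 2 * beta.
have dl0 : 0 < dl by rewrite /dl; lra.
(* An error [eta] in both exponents costs [(d - 1) * eta + 2 * eta = dl / 2], leaving half of the
   gap [dl]. *)
pose eta := dl / (2 * (d%:R + 1)).
have eta0 : 0 < eta by rewrite divr_gt0//; lra.
have etaE : (d%:R + 1) * eta = dl / 2 by rewrite /eta; field; rewrite gt_eqF//; lra.
(* Sum of the three thresholds on [t], so that it exceeds each of them; the 1 keeps [t] positive. *)
pose t0 := 1 + 384 * d%:R / dl ^+ 2 + 2 * d%:R + 2 * d%:R / eps.
have a0 : 0 <= 384 * d%:R / dl ^+ 2 by rewrite divr_ge0 ?sqr_ge0//; lra.
have b0 : 0 <= 2 * d%:R / eps by rewrite divr_ge0 ?(ltW eps0)//; lra.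
near=> m => dT T P Z iidZ lam' I lamlam' kI.
have Nt : ln ((N m)%:R : R) / ln m%:R < 2.
  by near: m; apply: (cvgr_lt _ cN); lra.
have kt : alpha - eta < ln ((k m)%:R : R) / ln m%:R.
  by near: m; apply: (cvgr_gt _ ck); lra.
have lt : ln ((lam m)^-1) / ln m%:R < beta + eta.
  by near: m; apply: (cvgr_lt _ clam); lra.
pose t := ln (m%:R : R).
have tt0 : t0 <= t.
  have : expR t0 <= m%:R by near: m; exact: nbhs_infty_ger.
  move=> H; rewrite -[t0]expRK ler_ln ?posrE ?expR_gt0//.
  by apply: lt_le_trans H; exact: expR_gt0.
have t0' : 0 < t by apply: lt_le_trans tt0; rewrite /t0; lra.
apply: (block_recovery_exponent P (N m) (k m) Z (lam m) lam' dl t eps) => //.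
- by apply: le_trans tt0; rewrite /t0; lra.
- by apply: le_trans tt0; rewrite /t0; lra.
- by apply: le_trans tt0; rewrite /t0; lra.
- by rewrite -ler_pdivrMr//; exact: ltW.
rewrite -ler_pdivlMr//.
have H : (d%:R - 1) * (alpha - eta) <= (d%:R - 1) * (ln (k m)%:R / t).
  by rewrite ler_wpM2l ?subr_ge0// ltW.
rewrite (_ : (_ - _) / t =
  (d%:R - 1) * (ln (k m)%:R / t) - 2 * (ln (lam m)^-1 / t)); last by ring.
have dlE : dl = (d%:R - 1) * alpha - 2 * beta by [].
lra.
Unshelve. all: by end_near.
Qed.
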